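(* Let $\xi_1,\ldots,\xi_n$ be independent nonnegative random variables with finite moments of all positive orders, and suppose that the moments $m_{i,k}=\mathbf{E}[\xi_i^k]$, $i=1,\ldots,n$, satisfy $$m_{i,k}=\mathcal{O}(k^{a_i k})\quad\text{as } k\to\infty,\quad\text{for } i=1,\ldots,n,$$ where $a_1,\ldots,a_n$ are positive constants. If $a_1+\cdots+a_n\le 2$, then the product $Z_n=\xi_1\cdots\xi_n$ is M-det.
   Context: A random variable $X$ with distribution function $F$ and moments $m_k=\mathbf{E}[X^k]$ (all finite) is called moment determinate (M-det) if $F$ is the only distribution having the moment sequence $\{m_k\}_{k=1}^\infty$. *)

(* Defs.v *)
From HB Require Import structures.
From mathcomp Require Export all_boot all_order all_algebra.
From mathcomp Require Export all_classical all_reals all_analysis.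

Set Implicit Arguments.
Unset Strict Implicit.
Unset Printing Implicit Defensive.

Import Order.TTheory GRing.Theory Num.Theory.
Import numFieldNormedType.Exports.

Local Open Scope classical_set_scope.
Local Open Scope ring_scope.

Definition independent_RVs d (T : measurableType d) (R : realType)
    (P : probability T R) (I : finType) (X : I -> {RV P >-> R}) : Prop :=
  forall (J : {set I}) (B : I -> set R), (forall i, measurable (B i)) ->
    P (\bigcap_(i in [set` J]) (X i @^-1` B i)) =
    (\prod_(i in J) P (X i @^-1` B i))%E.

Definition moment d (T : measurableType d) (R : realType)
    (P : probability T R) (X : T -> R) (k : nat) : \bar R :=
  ('E_P[fun t => (X t ^+ k)%R])%E.

Definition finite_moments d (T : measurableType d) (R : realType)
    (P : probability T R) (X : T -> R) : Prop :=
  forall k : nat, (0 < k)%N -> P.-integrable setT (fun t => (X t ^+ k)%:E).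

(* The competing distribution Q ranges over all Borel probability measures on
   the whole real line, even when X is nonnegative; its moments are those of
   the identity function under Q. *)
Definition moment_determinate d (T : measurableType d) (R : realType)
    (P : probability T R) (X : {RV P >-> R}) : Prop :=
  finite_moments P X /\
  forall Q : probability R R,
    finite_moments Q idfun ->
    (forall k : nat, (0 < k)%N -> moment Q idfun k = moment P X k) ->
    forall A : set R, measurable A -> Q A = distribution P X A.

Section rv_prod.
Context d (T : measurableType d) (R : realType) (P : probability T R).
Context (n : nat) (X : 'I_n -> {RV P >-> R}).

Definition rv_prod_fun (t : T) : R := \prod_(i < n) X i t.

Lemma measurable_rv_prod_fun : measurable_fun setT rv_prod_fun.
Proof. by apply: measurable_prod => i _; exact: measurable_funP. Qed.

HB.instance Definition _ :=
  isMeasurableFun.Build _ _ _ _ rv_prod_fun measurable_rv_prod_fun.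

Definition rv_prod : {RV P >-> R} := rv_prod_fun.

End rv_prod.

(* Main.v *)
Require Import Defs.
From mathcomp Require Import measurable_realfun pi_irrational.
From mathcomp Require Import ring lra zify.

(** The law [mu] of the product lives on the half-line, and by independence its
    moments are the products of the moments of the factors. As the exponents
    add up to at most 2, these are at most [C * B ^ k * (2 k)!], the size for
    which a measure on the half-line is determined by its moments. The
    competitor [Q] may charge the negative reals, and for measures on the whole
    line this growth is too fast to ensure determinacy; so the positivity of [mu] has
    to be used.

    The tool is the entire function [cosq z = cos (sqrt z)], with Taylor
    coefficients [(-1) ^ k / (2 k)!]. It is bounded by 1 on the right half-line
    and at least 1 on the left one, where its Taylor polynomials are nonnegative
    and increase to it. Suppose that all polynomials, weighted by [w], have the
    same integrals under [mu] and [Q]. Then so do all polynomials weighted by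
    [w * cosq (tau * _)] for a fixed small [tau] ([multiplier_step],
    [moment_multiplier_step]): the Taylor polynomials may be integrated term by
    term, on the right because [cosq (- tau |x|)] has finite integral by the
    growth of the moments ([integrable_poly_cosq]), and on the left because the
    [Q]-integrals of these nonnegative polynomials are controlled by
    [mu]-integrals. The step leaves [tau] unchanged, so it can be iterated, and
    [cosq (tau x) ^ n] has the same integrals under [mu] and [Q] for every [n].

    These integrals are bounded in [n] for [mu], while on the left
    [cosq (tau x) ^ n >= 1 + n tau |x| / 2]; hence [Q] does not charge the left
    half-line ([competitor_neg_eq0]). On the right [cosq (tau x)] lies in
    [[-1, 1]], where polynomials approximate the indicators of half-lines
    boundedly and pointwise ([cvg_step_poly]). So [mu] and [Q] agree on the sets
    where [cosq (tau x) > cosq (tau b)], and as [tau] tends to 0 these become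
    the rays [x < b] ([determinate_of_growth]). *)

Set Implicit Arguments.
Unset Strict Implicit.
Unset Printing Implicit Defensive.

Import Order.TTheory GRing.Theory Num.Theory.
Import numFieldNormedType.Exports.

Local Open Scope classical_set_scope.
Local Open Scope ring_scope.

(** * Products of independent nonnegative variables *)

Section integralM_of_indic.
Import HBNNSimple.

(** Both sides are monotone limits of finite positive combinations of the
    instances for indicators. *)
Lemma integralM_of_indic (R : realType) (d : measure_display)
    (T : measurableType d) (P : {measure set T -> \bar R})
    (X : {mfun T >-> R}) (G : T -> R) (c : R) (f : R -> R) :
  measurable_fun setT G -> (forall t, 0 <= G t) ->
  measurable_fun setT f -> (forall x, 0 <= f x) ->
  (forall B : set R, measurable B ->
    (\int[P]_t (G t * \1_B (X t))%:E = c%:E * \int[P]_t (\1_B (X t))%:E)%E) ->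
  (\int[P]_t (G t * f (X t))%:E = c%:E * \int[P]_t (f (X t))%:E)%E.
Proof.
move=> mG G0 mf f0 H.
have mf' : measurable_fun setT (fun x : R => (f x)%:E) by exact/measurable_EFinP.
pose h := nnsfun_approx measurableT mf'.
have hf x : (EFin \o h ^~ x) @ \oo --> (f x)%:E.
  by apply: (@cvg_nnsfun_approx _ _ _ _ measurableT (EFin \o f) mf') => // y _; rewrite lee_fin.
have ndh x : {homo (fun n => h n x) : m n / (m <= n)%N >-> m <= n}.
  by move=> m n mn; exact/lefP/nd_nnsfun_approx.
have mhX n : measurable_fun setT (fun t => h n (X t)).
  by apply: measurableT_comp; [exact: measurable_funP|exact: measurable_funP].
(* Monotone convergence along simple functions increasing to f. *)
have cvL : (\int[P]_t (G t * h n (X t))%:E @[n --> \oo] -->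
            \int[P]_t (G t * f (X t))%:E)%E.
  rewrite (_ : (\int[P]_t (G t * f (X t))%:E)%E =
     (\int[P]_t (limn (fun n => (G t * h n (X t))%:E)))%E); last first.
    apply: eq_integral => t _; apply/esym/cvg_lim => //.
    exact: (@cvgeZl _ _ _ _ _ (G t)%:E isT (hf (X t))).
  apply: cvg_monotone_convergence => //.
  - by move=> n; apply/measurable_EFinP; exact: measurable_funM.
  - by move=> n t _; rewrite lee_fin mulr_ge0.
  - by move=> t _ m n mn; rewrite lee_fin ler_wpM2l// ndh.
have cvR : (\int[P]_t (h n (X t))%:E @[n --> \oo] --> \int[P]_t (f (X t))%:E)%E.
  rewrite (_ : (\int[P]_t (f (X t))%:E)%E =
     (\int[P]_t (limn (fun n => (h n (X t))%:E)))%E); last first.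
    by apply: eq_integral => t _; apply/esym/cvg_lim => //; exact: hf.
  apply: cvg_monotone_convergence => //.
  - by move=> n; apply/measurable_EFinP.
  - by move=> n t _; rewrite lee_fin.
  - by move=> t _ m n mn; rewrite lee_fin ndh.
have {}cvR := @cvgeZl _ _ _ _ _ c%:E isT cvR.
apply: (cvg_unique _ cvL); rewrite //.
apply: cvg_trans cvR; apply: near_eq_cvg; near=> n; apply/esym.
have mp r : measurable (h n @^-1` [set r]) by exact: measurable_sfunP.
have mI r : measurable_fun setT (fun t => \1_(h n @^-1` [set r]) (X t) : R).
  by apply: measurableT_comp; [exact: measurable_indic|exact: measurable_funP].
have pos r x : 0 <= r * \1_(h n @^-1` [set r]) x.
  by rewrite -lee_fin EFinM; exact: nnfun_muleindic_ge0.
(* At stage n both integrals split along the level sets of the simple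
   function. *)
have E1 : (\int[P]_t (h n (X t))%:E =
  \sum_(r \in range (h n)) \int[P]_t (r * \1_(h n @^-1` [set r]) (X t))%:E)%E.
  rewrite -ge0_integral_fsum//.
  - by apply: eq_integral => t _; rewrite fsumEFin// -fimfunE.
  - by move=> r; apply/measurable_EFinP; exact: measurable_funM.
  - by move=> r t _; rewrite lee_fin.
have E2 : (\int[P]_t (G t * h n (X t))%:E =
  \sum_(r \in range (h n)) \int[P]_t (r * (G t * \1_(h n @^-1` [set r]) (X t)))%:E)%E.
  rewrite -ge0_integral_fsum//.
  - apply: eq_integral => t _; rewrite fsumEFin// [h n (X t)]fimfunE.
    congr EFin; rewrite !fsbig_finite//= mulr_sumr.
    by apply: eq_bigr => r _; rewrite mulrCA.
  - move=> r; apply/measurable_EFinP; apply: measurable_funM => //.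
    exact: measurable_funM.
  - by move=> r t _; rewrite lee_fin mulrCA mulr_ge0.
rewrite E1 E2 ge0_mule_fsumr; last first.
  by move=> r; apply: integral_ge0 => t _; rewrite lee_fin.
apply: eq_fsbigr => r /set_mem rX.
have r0 : 0 <= r by case: rX => x _ <-.
under eq_integral do rewrite EFinM.
under [in RHS]eq_integral do rewrite EFinM.
have mGI := measurable_funM mG (mI r).
rewrite ge0_integralZl_EFin//; last 2 first.
  by move=> t _; rewrite lee_fin mulr_ge0.
  exact/measurable_EFinP.
rewrite ge0_integralZl_EFin//; last exact/measurable_EFinP.
by rewrite H// muleCA.
Unshelve. all: by end_near. Qed.

End integralM_of_indic.

(** Independence is the case where all factors are indicators; the indicators
    are then replaced by arbitrary nonnegative functions one coordinate at a
    time, through [integralM_of_indic]. *)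
Lemma integral_prod_independent (R : realType) (d : measure_display)
    (T : measurableType d) (P : probability T R) (n : nat)
    (X : 'I_n -> {RV P >-> R}) (f : 'I_n -> R -> R) :
  independent_RVs X ->
  (forall i, measurable_fun setT (f i)) -> (forall i x, 0 <= f i x) ->
  (forall i, P.-integrable setT (fun t => (f i (X i t))%:E)) ->
  (\int[P]_t (\prod_i f i (X i t))%:E = \prod_i \int[P]_t (f i (X i t))%:E)%E.
Proof.
move=> indX.
have mfX i (g : R -> R) : measurable_fun setT g ->
    measurable_fun setT (fun t => g (X i t)).
  by move=> mg; apply: measurableT_comp => //; exact: measurable_funP.
(* Only the coordinates below m carry general functions. *)
suff H (m : nat) : forall f : 'I_n -> R -> R,
    (forall i, measurable_fun setT (f i)) -> (forall i x, 0 <= f i x) ->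
    (forall i, P.-integrable setT (fun t => (f i (X i t))%:E)) ->
    (forall i : 'I_n, (m <= i)%N ->
       exists2 B : set R, measurable B & f i = \1_B) ->
    (\int[P]_t (\prod_i f i (X i t))%:E =
     \prod_i \int[P]_t (f i (X i t))%:E)%E.
  move=> mf f0 fi; apply: (H n) => // i.
  by rewrite leqNgt ltn_ord.
elim: m => {f} [|m IH] f mf f0 fi fB.
  have {fB} /choice [B BP] : forall i, exists B, measurable B /\ f i = \1_B.
    by move=> i; have [B mB ->] := fB i (leq0n i); exists B.
  have fE i : f i = \1_(B i) by have [] := BP i.
  have mB i : measurable (B i) by have [] := BP i.
  have mXB i : measurable (X i @^-1` B i).
    by rewrite -[X in measurable X]setTI; exact: measurable_funP.
  have EI i : (\int[P]_t (f i (X i t))%:E = P (X i @^-1` B i))%E.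
    transitivity (\int[P]_t (\1_(X i @^-1` B i) t)%:E)%E.
      by apply: eq_integral => t _; rewrite fE.
    by rewrite integral_indic// setIT.
  transitivity (P (\bigcap_(i in [set` [set: 'I_n]%SET]) (X i @^-1` B i))).
    rewrite -[X in P X]setIT -integral_indic//; last first.
      by apply: fin_bigcap_measurable => //; exact: finite_finset.
    apply: eq_integral => t _; congr EFin.
    rewrite indicE; have [/set_mem tB|tB] := boolP (t \in _).
      rewrite big1// => i _; rewrite fE indicE mem_set//.
      by apply: (tB i); rewrite /= inE.
    have [i tBi] : exists i, ~ B i (X i t).
      apply/existsNP => tBall; move/negP: tB; apply.
      by rewrite inE => i _; exact: tBall.
    by rewrite (bigD1 i)//= fE indicE memNset// mul0r.
  rewrite indX//; apply: eq_big => i; first by rewrite inE.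
  by rewrite EI.
have [nm|mn] := leqP n m.
  by apply: IH => // i mi; have := leq_ltn_trans (leq_trans nm mi) (ltn_ord i); rewrite ltnn.
(* The coordinate m is the one promoted from an indicator to a general f. *)
pose i0 := Ordinal mn.
pose g (B : set R) i := if i == i0 then \1_B : R -> R else f i.
have mg (B : set R) i : measurable B -> measurable_fun setT (g B i).
  by move=> mB; rewrite /g; case: ifP => // _; exact: measurable_indic.
have fin i : (\int[P]_t (f i (X i t))%:E)%E \is a fin_num.
  exact: integrable_fin_num.
pose c := fine (\prod_(i | i != i0) \int[P]_t (f i (X i t))%:E)%E.
have cE : (c%:E = \prod_(i | i != i0) \int[P]_t (f i (X i t))%:E)%E.
  by rewrite fineK// prode_fin_num.
pose G t := \prod_(i | i != i0) f i (X i t).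
transitivity (\int[P]_t (G t * f i0 (X i0 t))%:E)%E.
  by apply: eq_integral => t _; rewrite (bigD1 i0)//= mulrC.
rewrite [RHS](bigD1 i0)//= -cE muleC.
apply: integralM_of_indic => //.
- rewrite /G; under eq_fun do rewrite big_mkcond.
  apply: measurable_prod => i _; have [_|_] := boolP (i != i0); last exact: measurable_cst.
  exact: mfX.
- by move=> t; apply: prodr_ge0.
move=> B mB.
have gB i : i != i0 -> g B i = f i by rewrite /g => /negbTE ->.
have gB0 : g B i0 = \1_B by rewrite /g eqxx.
transitivity (\int[P]_t (\prod_i g B i (X i t))%:E)%E.
  apply: eq_integral => t _; rewrite [in RHS](bigD1 i0)//= gB0 mulrC.
  by congr (_ * _)%:E; apply: eq_bigr => i ii0; rewrite gB.
rewrite IH.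
- rewrite (bigD1 i0)//= gB0 cE muleC; congr (_ * _)%E.
  by apply: eq_bigr => i ii0; rewrite gB.
- by move=> i; exact: mg.
- by move=> i x; rewrite /g; case: ifP.
- move=> i; have [->|ii0] := eqVneq i i0; last by rewrite gB.
  rewrite gB0.
  suff mXB : measurable (X i0 @^-1` B) by exact: (integrable_indic P mXB).
  by rewrite -[X in measurable X]setTI; exact: measurable_funP.
- move=> i mi; have [->|ii0] := eqVneq i i0; first by rewrite gB0; exists B.
  by rewrite gB//; apply: fB; rewrite ltn_neqAle mi andbT eq_sym.
Qed.

(** * Factorial growth of the product of the moments *)

Lemma fact_sqr_le k : (k`! ^ 2 <= (2 * k)`!)%N.
Proof.
have := @bin_fact (2 * k) k; rewrite mul2n -addnn leq_addr addnK => /(_ isT) <-.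
by rewrite -mulnn leq_pmull// bin_gt0 leq_addr.
Qed.

Lemma pow_self_le (R : realType) k : k%:R ^+ k <= expR k%:R * k`!%:R :> R.
Proof.
case: k => [|k]; first by rewrite expr0 expR0 fact0 mulr1.
rewrite -ler_pdivrMr ?ltr0n ?fact_gt0//.
by apply: le_trans (expR_ge1Dxn k (ler0n _ _)); rewrite lerDr.
Qed.

(** From [k ^ k <= e ^ k * k!] and [k! ^ 2 <= (2 k)!]. *)
Lemma powR_double_le (R : realType) k :
  (k%:R : R) `^ (2 * k%:R) <= (expR 2) ^+ k * (2 * k)`!%:R.
Proof.
rewrite mulrC powRrM powR_mulrn// powR_mulrn ?exprn_ge0//.
have le2 : (k%:R ^+ k) ^+ 2 <= (expR k%:R * k`!%:R) ^+ 2 :> R.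
  by rewrite ler_sqr ?nnegrE ?exprn_ge0 ?mulr_ge0 ?expR_ge0// pow_self_le.
apply: le_trans le2 _; rewrite exprMn -natrX -!expRM_natl.
rewrite [k%:R * 2]mulrC; apply: ler_pM; rewrite ?expR_ge0//.
by rewrite ler_nat fact_sqr_le.
Qed.

(** The sum of the exponents enters through the product of the powers of [k];
    the finitely many [k] for which the asymptotic bounds say nothing are
    absorbed in the constant. *)
Lemma prod_growth_factorial (R : realType) (n : nat) (m : 'I_n -> nat -> R)
    (a : 'I_n -> R) :
  (forall i, m i =O_\oo (fun k : nat => k%:R `^ (a i * k%:R))) ->
  \sum_i a i <= 2 ->
  exists C : R, exists B : R, [/\ 0 <= C, 1 <= B &
    forall k, `|\prod_i m i k| <= C * B ^+ k * (2 * k)`!%:R].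
Proof.
move=> mO a2.
have {mO} /choice[K HK] : forall i, exists K : R, 0 <= K /\
    \forall k \near \oo, `|m i k| <= K * (k%:R `^ (a i * k%:R)).
  move=> i; have /eqO_exP[K K0 HK] := mO i; exists K; split; first exact: ltW.
  near=> k; have : `|m i k| <= K * `|(k%:R : R) `^ (a i * k%:R)|.
    by near: k.
  by rewrite [`|_ `^ _|]ger0_norm// powR_ge0.
have K0 i : 0 <= K i by have [] := HK i.
have : \forall k \near \oo, forall i, `|m i k| <= K i * (k%:R `^ (a i * k%:R)).
  by apply: filter_forall => i; have [] := HK i.
move=> [N _ HN].
have B1 : 1 <= expR 2 :> R by rewrite -expR0 ler_expR.
have prodK : 0 <= \prod_i K i by apply: prodr_ge0.
have sum0 : 0 <= \sum_(k < N.+1) `|\prod_i m i k| by apply: sumr_ge0.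
exists (\prod_i K i + \sum_(k < N.+1) `|\prod_i m i k|), (expR 2).
split=> // [|k]; first exact: addr_ge0.
have EB0 : 0 <= expR 2 ^+ k :> R by rewrite exprn_ge0// expR_ge0.
rewrite -mulrA mulrDl.
have [kN|Nk] := ltnP k N.+1.
  apply: ler_wpDl; first by rewrite !mulr_ge0.
  rewrite (bigD1 (Ordinal kN))//= mulrDl; apply: ler_wpDr.
    by rewrite !mulr_ge0// sumr_ge0.
  rewrite ler_peMr// mulr_ege1//; first exact: exprn_ege1.
  by rewrite ler1n fact_gt0.
apply: ler_wpDr; first by rewrite !mulr_ge0.
rewrite normr_prod.
apply: le_trans (_ : \prod_i (K i * (k%:R `^ (a i * k%:R))) <= _).
  by apply: ler_prod => i _; rewrite normr_ge0/=; apply: HN; exact: ltnW.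
rewrite big_split/= ler_wpM2l//; apply: le_trans (powR_double_le R k).
have k0 : (0 < k)%N by exact: leq_trans Nk.
have -> : \prod_i (k%:R : R) `^ (a i * k%:R) = k%:R `^ (\sum_i (a i * k%:R)).
  elim/big_ind2 : _ => [|x y u v -> ->|//]; first by rewrite powRr0.
  by rewrite powRD// pnatr_eq0 -lt0n k0 implybT.
by rewrite ler_powR ?ler1n// -mulr_suml ler_wpM2r.
Unshelve. all: by end_near. Qed.

(** * The entire function cos(sqrt z) *)

Section cosq.
Context {R : realType}.
Implicit Types (x z : R) (N : nat).

(** The entire function [\sum_k (-1) ^ k z ^ k / (2 k)!], equal to
    [cos (sqrt z)] for [z >= 0] and to [cosh (sqrt (- z))] for [z < 0]. *)
Definition cosq z : R :=
  if 0 <= z then cos (Num.sqrt z)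
  else (expR (Num.sqrt (- z)) + expR (- Num.sqrt (- z))) / 2.

Definition cosq_poly N : {poly R} := \poly_(k < N) ((-1) ^+ k / (k.*2)`!%:R).

Lemma horner_cosq_poly N z :
  (cosq_poly N).[z] = \sum_(k < N) (-1) ^+ k * z ^+ k / (k.*2)`!%:R.
Proof. by rewrite horner_poly; apply: eq_bigr => k _; rewrite mulrAC. Qed.

Lemma expR_even_series x :
  series (fun k => x ^+ k.*2 / (k.*2)`!%:R) @ \oo --> (expR x + expR (- x)) / 2.
Proof.
pose u n := (exp_coeff x n + exp_coeff (- x) n) / 2.
have us : series u @ \oo --> (expR x + expR (- x)) / 2.
  rewrite (_ : series u = fun n =>
      (series (exp_coeff x) n + series (exp_coeff (- x)) n) / 2); last first.
    by apply/funext => n; rewrite /series/= -big_split/= mulr_suml.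
  by apply: cvgMl; apply: cvgD; apply: is_cvg_series_exp_coeff.
have /(@cvg_series_cvg_series_group _ _ 2)/(_ isT) := cvgP _ us.
rewrite (cvg_lim _ us)//; apply: cvg_trans.
rewrite [X in _ --> series X @ \oo](_ : _ = (fun k => x ^+ k.*2 / (k.*2)`!%:R))//.
have even_pow k : (- x) ^+ k.*2 = x ^+ k.*2 by rewrite -mul2n !exprM sqrrN.
have expE y n : exp_coeff y n = y ^+ n / n`!%:R by [].
have u_even k : u k.*2 = x ^+ k.*2 / (k.*2)`!%:R.
  by rewrite /u !expE even_pow mulrDl -splitr.
have u_odd k : u k.*2.+1 = 0.
  by rewrite /u !expE !exprS even_pow 2!mulNr subrr mul0r.
by apply/funext => k; rewrite /= 2!muln2 doubleS big_nat_recr//= big_nat1 u_odd addr0.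
Qed.

Lemma horner_cosq_poly_le0 N z : z <= 0 ->
  (cosq_poly N).[z] = \sum_(k < N) (- z) ^+ k / (k.*2)`!%:R.
Proof.
move=> z0; rewrite horner_cosq_poly; apply: eq_bigr => k _.
by rewrite -exprMn mulN1r.
Qed.

Lemma cosq_poly_cvg z : (cosq_poly N).[z] @[N --> \oo] --> cosq z.
Proof.
rewrite /cosq; case: ifPn => [z0|]; last rewrite -ltNge => z0.
  have := @cvg_cos_coeff' R (Num.sqrt z).
  apply: cvg_trans; apply: near_eq_cvg; near=> N.
  rewrite horner_cosq_poly /series/= big_mkord; apply: eq_bigr => k _.
  by rewrite /cos_coeff' -muln2 exprM exprAC sqr_sqrtr// exprnP.
have := @expR_even_series (Num.sqrt (- z)).
apply: cvg_trans; apply: near_eq_cvg; near=> N.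
rewrite horner_cosq_poly_le0 1?ltW// /series/= big_mkord; apply: eq_bigr => k _.
by rewrite -mul2n exprM sqr_sqrtr// oppr_ge0 ltW.
Unshelve. all: by end_near. Qed.

Lemma cosq_norm_le1 z : 0 <= z -> `|cosq z| <= 1.
Proof. by move=> z0; rewrite /cosq z0 cos_max. Qed.

Lemma cosq_poly_ge0 N z : z <= 0 -> 0 <= (cosq_poly N).[z].
Proof.
move=> z0; rewrite horner_cosq_poly_le0//; apply: sumr_ge0 => k _.
by rewrite divr_ge0// exprn_ge0// oppr_ge0.
Qed.

Lemma cosq_poly_nd z : z <= 0 ->
  {homo (fun N => (cosq_poly N).[z]) : M N / (M <= N)%N >-> M <= N}.
Proof.
move=> z0; apply/nondecreasing_seqP => N; rewrite !horner_cosq_poly_le0//.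
by rewrite big_ord_recr/= lerDl divr_ge0// exprn_ge0// oppr_ge0.
Qed.

Lemma cosq_poly_le N z : z <= 0 -> (cosq_poly N).[z] <= cosq z.
Proof.
move=> z0; rewrite -(cvg_lim _ (@cosq_poly_cvg z))//.
apply: nondecreasing_cvgn_le; first exact: cosq_poly_nd.
by apply: cvgP; exact: cosq_poly_cvg.
Qed.

(** For [z <= 0] all Taylor terms are nonnegative; keep the first two. *)
Lemma cosq_ge1D z : z <= 0 -> 1 - z / 2 <= cosq z.
Proof.
move=> z0; apply: le_trans (cosq_poly_le 2 z0).
by rewrite horner_cosq_poly_le0// big_ord_recl big_ord1/= !expr0 expr1 divr1 mulNr.
Qed.

Lemma cosq_ge1 z : z <= 0 -> 1 <= cosq z.
Proof.
move=> z0; apply: le_trans (cosq_ge1D z0).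
by rewrite lerDl oppr_ge0 mulr_le0_ge0// invr_ge0.
Qed.

(** Replacing [z] by [- |z|] makes all Taylor terms nonnegative. This is the
    majorant for term-by-term integration. *)
Lemma cosq_poly_norm_le N z : `|(cosq_poly N).[z]| <= cosq (- `|z|).
Proof.
have z0 : - `|z| <= 0 by rewrite oppr_le0.
apply: le_trans (cosq_poly_le N z0).
rewrite horner_cosq_poly horner_cosq_poly_le0// opprK.
apply: le_trans (ler_norm_sum _ _ _) _; apply: ler_sum => k _.
by rewrite normrM normfV normrM normr_nat !normrX normrN1 expr1n mul1r.
Qed.

Lemma measurable_cosq : measurable_fun setT cosq.
Proof.
apply: (measurable_fun_cvg (h := fun N => horner (cosq_poly N))).
  by move=> N; exact: measurable_poly.
by move=> z _; exact: cosq_poly_cvg.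
Qed.

End cosq.

(** * Integrability of cosq under factorial growth of the moments *)

Lemma integral_nd_limit_le (R : realType) (d : measure_display)
    (T : measurableType d) (mu : {measure set T -> \bar R}) (D : set T)
    (f_ : nat -> T -> R) (f : T -> R) (K : \bar R) :
  measurable D -> (forall n, measurable_fun D (f_ n)) ->
  (forall n x, D x -> 0 <= f_ n x) ->
  (forall x, D x -> {homo f_^~ x : m n / (m <= n)%N >-> m <= n}) ->
  (forall x, D x -> f_ n x @[n --> \oo] --> f x) ->
  (forall n, (\int[mu]_(x in D) (f_ n x)%:E <= K)%E) ->
  (\int[mu]_(x in D) (f x)%:E <= K)%E.
Proof.
move=> mD mf f0 ndf cvf intf.
have -> : (\int[mu]_(x in D) (f x)%:E)%E =
    (\int[mu]_(x in D) limn (fun n => (f_ n x)%:E))%E.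
  apply: eq_integral => x /set_mem Dx; apply/esym/cvg_lim => //.
  by apply: cvg_EFin; [exact: nearW|exact: cvf].
have cv : (\int[mu]_(x in D) (f_ n x)%:E @[n --> \oo] -->
    \int[mu]_(x in D) limn (fun n => (f_ n x)%:E))%E.
  apply: cvg_monotone_convergence => //.
  by move=> n; exact/measurable_EFinP.
by apply: cvge_le cv; exact: nearW.
Qed.

Lemma fact_add_le a b : ((a + b)`! <= 2 ^ (a + b) * (a`! * b`!))%N.
Proof.
rewrite -(bin_fact (leq_addr b a)) addKn leq_mul2r; apply/orP; right.
rewrite -[2%N]/(1 + 1)%N expnDn (bigD1 (inord a))//=.
rewrite inordK ?ltnS ?leq_addr//.
by rewrite !exp1n !muln1 leq_addr.
Qed.

Section subexponential.
Context {R : realType} (nu : probability R R) (C B : R).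
Hypotheses (C0 : 0 <= C) (B1 : 1 <= B).
Hypothesis nu_int : forall k, nu.-integrable setT (fun x : R => (x ^+ k)%:E).
Hypothesis nu_growth : forall k,
  (\int[nu]_x (x ^+ k)%:E <= (C * B ^+ k * (2 * k)`!%:R)%:E)%E.

Let measurable_monomial (c : R) k : measurable_fun setT (fun x : R => c * x ^+ k).
Proof. by apply: measurable_funM; [exact: measurable_cst|exact: exprn_measurable]. Qed.

(** The Taylor coefficients of [cosq (tau * x) + cosq (- (tau * x))]. *)
Let even_coef (tau : R) k : R := (1 + (-1) ^+ k) * tau ^+ k / (k.*2)`!%:R.

(** The even part of [cosq] involves only the monomials of even degree. These
    are nonnegative on the whole line, so that their integrals add up to a
    geometric series without any absolute moment of odd order. *)
Lemma integral_even_cosq_le (tau : R) (j : nat) : 0 < tau -> 8 * tau * B <= 1 ->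
  (\int[nu]_x (x ^+ (2 * j) * (cosq (tau * x) + cosq (- (tau * x))))%:E < +oo)%E.
Proof.
move=> tau0 tauB.
(* K bounds the term of degree 0; each further degree costs a factor
   4 * tau * B <= 1 / 2. *)
pose K : R := 2 * C * B ^+ (2 * j) * 2 ^+ (4 * j) * (4 * j)`!%:R.
have K0 : 0 <= K by rewrite !mulr_ge0// ?exprn_ge0// ?(le_trans ler01).
pose S N x := \sum_(k < N) even_coef tau k * x ^+ (2 * j + k).
have SE N x : S N x =
    x ^+ (2 * j) * ((cosq_poly N).[tau * x] + (cosq_poly N).[- (tau * x)]).
  rewrite !horner_cosq_poly -big_split/= mulr_sumr; apply: eq_bigr => k _.
  rewrite /even_coef exprD -(mulN1r (tau * x)) !exprMn.
  rewrite [(-1) ^+ k * ((-1) ^+ k * _)]mulrA -expr2 sqrr_sign.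
  by ring.
have term0 k x : 0 <= even_coef tau k * x ^+ (2 * j + k).
  rewrite /even_coef -signr_odd.
  case: (boolP (odd k)) => [ok|ek]; first by rewrite expr1 subrr !mul0r.
  apply: mulr_ge0; last first.
    by apply: exprn_even_ge0; rewrite oddD oddM/= (negbTE ek).
  by rewrite expr0 divr_ge0// mulr_ge0 ?exprn_ge0// ?ltW// addr_ge0.
apply: le_lt_trans (ltry (K * 2)).
apply: (@integral_nd_limit_le _ _ _ _ _ S) => //.
- by move=> N; apply: measurable_sum => k; exact: measurable_monomial.
- by move=> N x _; apply: sumr_ge0 => k _.
- move=> x _; apply/nondecreasing_seqP => N.
  by rewrite /S big_ord_recr/= lerDl.
- move=> x _; under eq_fun do rewrite SE.
  by apply: cvgMr; apply: cvgD; exact: cosq_poly_cvg.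
move=> N.
have -> : (\int[nu]_x (S N x)%:E =
    \sum_(k < N) \int[nu]_x (even_coef tau k * x ^+ (2 * j + k))%:E)%E.
  under eq_integral do rewrite -sumEFin.
  rewrite ge0_integral_sum//.
  - by move=> k; apply/measurable_EFinP; exact: measurable_monomial.
  - by move=> k x _; rewrite lee_fin.
apply: le_trans (_ : ((\sum_(k < N) K * 2^-1 ^+ k)%:E <= _)%E); last first.
  rewrite lee_fin -mulr_sumr ler_wpM2l//.
  have half_lt1 : `|2^-1 : R| < 1 by rewrite ger0_norm// invf_lt1// ltr1n.
  have half_gt0 : 0 < 2^-1 :> R by [].
  have := geometric_le_lim N ler01 half_gt0 half_lt1.
  rewrite /series/= big_mkord => half_sum.
  apply: (@le_trans _ _ (1 / (1 - 2^-1))); last first.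
    by rewrite (_ : 1 - 2^-1 = 2^-1) ?invrK ?mul1r//; lra.
  by apply: le_trans half_sum; apply: ler_sum => k _; rewrite mul1r.
rewrite -sumEFin; apply: lee_sum => k _.
have sgn0 : 0 <= 1 + (-1) ^+ k :> R.
  by rewrite -signr_odd; case: (odd k); rewrite ?expr1 ?expr0; lra.
have c0 : 0 <= even_coef tau k.
  by rewrite divr_ge0// mulr_ge0// exprn_ge0// ltW.
under eq_integral do rewrite EFinM.
rewrite integralZl//.
apply: le_trans (lee_wpmul2l _ (nu_growth _)) _; rewrite ?lee_fin//.
have sgn2 : 1 + (-1) ^+ k <= 2 :> R.
  by rewrite -signr_odd; case: (odd k); rewrite ?expr1 ?expr0; lra.
have F0 : 0 < (k.*2)`!%:R :> R by rewrite ltr0n fact_gt0.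
have factle : (2 * (2 * j + k))`!%:R / (k.*2)`!%:R <=
    2 ^+ (4 * j) * 4 ^+ k * (4 * j)`!%:R :> R.
  rewrite ler_pdivrMr//.
  have := fact_add_le (k.*2) (4 * j).
  rewrite (_ : 2 * (2 * j + k) = k.*2 + 4 * j)%N; last by rewrite -mul2n; lia.
  rewrite -(ler_nat R) => /le_trans; apply.
  rewrite natrM natrX natrM exprD -mul2n [2 ^+ (2 * k)]exprM.
  rewrite (_ : 2 ^+ 2 = 4 :> R); last by rewrite -natrX.
  by rewrite le_eqVlt; apply/orP; left; apply/eqP; ring.
have tBle : (4 * tau * B) ^+ k <= 2^-1 ^+ k.
  have tB0 : 0 <= tau * B by rewrite mulr_ge0 ?ltW// (lt_le_trans ltr01).
  by rewrite lerXn2r ?nnegrE//; lra.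
rewrite /even_coef.
rewrite [leLHS](_ : _ = (1 + (-1) ^+ k) * (C * B ^+ (2 * j) *
    (tau ^+ k * B ^+ k) * ((2 * (2 * j + k))`!%:R / (k.*2)`!%:R))); last first.
  by rewrite [B ^+ (_ + _)]exprD; ring.
have P0 : 0 <= C * B ^+ (2 * j) * (tau ^+ k * B ^+ k).
  by rewrite !mulr_ge0// ?exprn_ge0// ?ltW// (lt_le_trans ltr01).
apply: (@le_trans _ _ (2 * (C * B ^+ (2 * j) * (tau ^+ k * B ^+ k) *
   (2 ^+ (4 * j) * 4 ^+ k * (4 * j)`!%:R)))).
  apply: ler_pM => //; last by rewrite ler_wpM2l.
  by rewrite mulr_ge0// divr_ge0// ltW.
rewrite [leLHS](_ : _ = K * (4 * tau * B) ^+ k); last first.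
  by rewrite /K !exprMn; ring.
by rewrite ler_wpM2l.
Qed.


(** One of [cosq (tau x)] and [cosq (- tau x)] is [cosq (- |tau x|)] and the
    other is a cosine, so that [cosq (- |z|) <= cosq z + cosq (- z) + 1]. *)
Lemma integrable_poly_cosq (tau : R) (p : {poly R}) :
  0 < tau -> 8 * tau * B <= 1 ->
  nu.-integrable setT (fun x : R => (p.[x] * cosq (- `|tau * x|))%:E).
Proof.
move=> tau0 tauB.
have mcosq (f : R -> R) : measurable_fun setT f ->
    measurable_fun setT (fun x : R => cosq (f x)).
  by move=> mf; apply: measurableT_comp => //; exact: measurable_cosq.
have mtau : measurable_fun setT (fun x : R => tau * x) by exact: measurable_funM.
have mabs : measurable_fun setT (fun x : R => cosq (- `|tau * x|)).
  by apply: mcosq; apply: measurable_funN; exact: measurableT_comp.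
have even_ge0 z : 0 <= cosq z + cosq (- z) :> R.
  have [z0|z0] := leP 0 z.
    have := cosq_norm_le1 z0; rewrite ler_norml => /andP[h _].
    have := @cosq_ge1 _ (- z); rewrite oppr_le0 => /(_ z0); lra.
  have nz0 : 0 <= - z by rewrite oppr_ge0 ltW.
  have := cosq_norm_le1 nz0; rewrite ler_norml => /andP[h _].
  have := cosq_ge1 (ltW z0); lra.
have even_le z : cosq (- `|z|) <= cosq z + cosq (- z) + 1 :> R.
  have [z0|z0] := leP 0 z.
    by have := cosq_norm_le1 z0; rewrite (ger0_norm z0) ler_norml => /andP[h _]; lra.
  have nz0 : 0 <= - z by rewrite oppr_ge0 ltW.
  have := cosq_norm_le1 nz0; rewrite ler_norml => /andP[h _].
  by rewrite (ltr0_norm z0) opprK; lra.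
have abs_ge0 (z : R) : 0 <= cosq (- `|z|) :> R.
  by apply: le_trans ler01 _; apply: cosq_ge1; rewrite oppr_le0.
have int_even j : nu.-integrable setT (fun x : R =>
    (x ^+ (2 * j) * (cosq (tau * x) + cosq (- (tau * x))))%:E).
  apply/integrableP; split.
    apply/measurable_EFinP; apply: measurable_funM => //.
    by apply: measurable_funD; apply: mcosq => //; exact: measurable_funN.
  apply: le_lt_trans (integral_even_cosq_le j tau0 tauB).
  rewrite le_eqVlt; apply/orP; left; apply/eqP; apply: eq_integral => x _.
  by rewrite gee0_abs// lee_fin mulr_ge0// exprn_even_ge0// oddM.
have int_abs j : nu.-integrable setT (fun x : R =>
    (x ^+ (2 * j) * cosq (- `|tau * x|))%:E).
  apply: le_integrable (integrableD measurableT (int_even j) (nu_int (2 * j))) => //.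
    by apply/measurable_EFinP; exact: measurable_funM.
  move=> x _; rewrite -EFinD lee_fin.
  have X0 : 0 <= x ^+ (2 * j) by rewrite exprn_even_ge0// oddM.
  have le0 := mulr_ge0 X0 (abs_ge0 (tau * x)).
  have ev0 := mulr_ge0 X0 (even_ge0 (tau * x)).
  rewrite (ger0_norm le0) (ger0_norm (addr_ge0 ev0 X0)).
  by rewrite -[X in _ + X]mulr1 -mulrDr ler_wpM2l.
(* Odd powers are dominated through |y| <= 1 + y ^ 2. *)
pose g (i : nat) x : R := `|p`_i| * ((1 + x ^+ (2 * i)) * cosq (- `|tau * x|)).
have int_g i : nu.-integrable setT (fun x => (g i x)%:E).
  rewrite /g; under eq_fun do rewrite EFinM mulrDl EFinD.
  apply: integrableZl => //; apply: integrableD => //.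
  by have := int_abs 0%N; under eq_fun do rewrite muln0 expr0.
have int_sum := integrable_sum measurableT (iota 0 (size p)) (P := xpredT)
  (fun i _ => int_g i).
apply: le_integrable int_sum => //.
  by apply/measurable_EFinP; apply: measurable_funM => //; exact: measurable_poly.
move=> x _; rewrite sumEFin lee_fin.
have X0 i : 0 <= 1 + x ^+ (2 * i) by rewrite addr_ge0// exprn_even_ge0// oddM.
rewrite [leRHS]ger0_norm; last by apply: sumr_ge0 => i _; rewrite !mulr_ge0.
rewrite normrM [X in _ * X]ger0_norm// horner_coef -(big_mkord xpredT (fun i => p`_i * x ^+ i)).
rewrite /g; under [leRHS]eq_bigr do rewrite mulrA.
rewrite -mulr_suml ler_wpM2r// /index_iota subn0.
apply: le_trans (ler_norm_sum _ _ _) _; apply: ler_sum => i _.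
rewrite normrM ler_wpM2l// mulnC exprM -[X in 1 + X]real_normK ?num_real//.
by have := sqr_ge0 (1 - `|x ^+ i|); have := normr_ge0 (x ^+ i); nra.
Qed.

End subexponential.

(** * Multiplying a weight by cosq *)

(** In this section [nu] stands for either of the two measures to be compared;
    [mu], which does not charge the negative reals, serves as reference for
    it. *)
Section multiplier_step.
Context {R : realType} (mu nu : probability R R) (w : R -> R) (tau : R).
Hypothesis mw : measurable_fun setT w.
Hypothesis w_norm : forall x, 0 <= x -> `|w x| <= 1.
Hypothesis w_ge0 : forall x, x < 0 -> 0 <= w x.
Hypothesis tau_gt0 : 0 < tau.
Hypothesis mu_neg : mu `]-oo, 0%R[%classic = 0%E.
Hypothesis mu_cosq : forall p : {poly R},
  mu.-integrable setT (fun x : R => (p.[x] * cosq (- `|tau * x|))%:E).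
Hypothesis nu_cosq : forall p : {poly R},
  nu.-integrable setT (fun x : R => (p.[x] * cosq (- `|tau * x|))%:E).
Hypothesis mu_w : forall p : {poly R},
  mu.-integrable setT (fun x : R => (p.[x] * w x)%:E).
Hypothesis nu_w : forall p : {poly R},
  nu.-integrable setT (fun x : R => (p.[x] * w x)%:E).
Hypothesis nu_mu_w : forall p : {poly R},
  (\int[nu]_x (p.[x] * w x)%:E = \int[mu]_x (p.[x] * w x)%:E)%E.

Let D (x : R) : R := cosq (- `|tau * x|).

Let D_ge1 x : 1 <= D x.
Proof. by apply: cosq_ge1; rewrite oppr_le0. Qed.

Let D_ge0 x : 0 <= D x. Proof. exact: le_trans ler01 (D_ge1 x). Qed.

Let T N : {poly R} := cosq_poly N \Po (tau *: 'X).

Let TE N x : (T N).[x] = (cosq_poly N).[tau * x].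
Proof. by rewrite horner_comp hornerZ hornerX. Qed.

Let T_norm N x : `|(T N).[x]| <= D x.
Proof. by rewrite TE; exact: cosq_poly_norm_le. Qed.

Let mD : measurable_fun setT D.
Proof.
apply: (@measurableT_comp _ _ _ _ _ _ cosq); first exact: measurable_cosq.
by apply: measurable_funN; apply: measurableT_comp => //; exact: measurable_funM.
Qed.

Let mneg : measurable (`]-oo, 0%R[%classic : set R). Proof. exact: measurable_itv. Qed.

Let mcosq_tau : measurable_fun setT (fun x : R => cosq (tau * x)).
Proof.
apply: (@measurableT_comp _ _ _ _ _ _ cosq); first exact: measurable_cosq.
exact: measurable_funM.
Qed.

Let mp (p : {poly R}) : measurable_fun setT (horner p).
Proof. exact: measurable_poly. Qed.

Let negE (x : R) : (`]-oo, 0%R[%classic : set R) x -> x < 0.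
Proof. by rewrite /= in_itv. Qed.

(** On the left half-line the Taylor polynomials of [cosq (tau * x)] are
    nonnegative and increasing. Their [nu]-integrals against [q * w] are
    bounded: the integral over the whole line equals that for [mu], and the
    right half-line is dominated by [q * cosq (- |tau x|)] for both measures. *)
Lemma integrable_neg_part (q : {poly R}) : (forall x, 0 <= q.[x]) ->
  nu.-integrable `]-oo, 0%R[%classic (fun x : R => (q.[x] * w x * cosq (tau * x))%:E).
Proof.
move=> q0.
pose F N x : R := (q * T N).[x] * w x.
have FE N x : F N x = q.[x] * w x * (cosq_poly N).[tau * x].
  by rewrite /F hornerM TE mulrAC.
have F_norm N x : 0 <= x -> `|F N x| <= q.[x] * D x.
  move=> x0; rewrite /F hornerM !normrM (ger0_norm (q0 x)) -mulrA ler_wpM2l//.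
  by rewrite -[leRHS]mulr1 ler_pM// w_norm.
have T_ge0 N x : x < 0 -> 0 <= (cosq_poly N).[tau * x].
  by move=> x0; rewrite cosq_poly_ge0// pmulr_rle0// ltW.
have F_ge0 N x : x < 0 -> 0 <= F N x.
  by move=> x0; rewrite FE !mulr_ge0// ?T_ge0// w_ge0.
have qD0 x : 0 <= q.[x] * D x by rewrite mulr_ge0.
have mF N : measurable_fun setT (F N) by exact: measurable_funM.
have mqD : measurable_fun setT (fun x : R => q.[x] * D x).
  exact: measurable_funM.
pose K := (\int[mu]_x (q.[x] * D x)%:E + \int[nu]_x (q.[x] * D x)%:E)%E.
have Kfin : (K < +oo)%E by rewrite lte_add_pinfty// integrable_lty.
have F_mu N : (\int[mu]_x (F N x)%:E <= \int[mu]_x (q.[x] * D x)%:E)%E.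
  rewrite (negligible_integral mneg measurableT (mu_w (q * T N)) mu_neg).
  rewrite (negligible_integral mneg measurableT (mu_cosq q) mu_neg).
  apply: le_integral.
  - exact: measurableD.
  - by apply: integrableS (mu_w (q * T N)) => //; exact: measurableD.
  - by apply: integrableS (mu_cosq q) => //; exact: measurableD.
  move=> x /set_mem[_ /negP]; rewrite /= in_itv/= -leNgt => x0.
  by rewrite lee_fin (le_trans (ler_norm _))// F_norm.
have F_nu N : (\int[nu]_(x in `]-oo, 0%R[%classic) (F N x)%:E <= K)%E.
  apply: (@le_trans _ _ (\int[nu]_x (F N x + q.[x] * D x)%:E)%E).
    rewrite [leLHS]integral_mkcond; apply: ge0_le_integral => //.
    - move=> x _; rewrite patchE; case: ifPn => // /set_mem/negE x0.
      by rewrite lee_fin F_ge0.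
    - apply/(measurable_restrictT _ mneg); apply/measurable_EFinP.
      exact: measurable_funS (mF N).
    - by apply/measurable_EFinP; exact: measurable_funD.
    - move=> x _; rewrite patchE; case: ifPn => [_|/negP xneg].
        by rewrite lee_fin lerDl.
      have x0 : 0 <= x by rewrite leNgt; apply/negP => x0; apply: xneg; rewrite inE/= in_itv.
      by have := F_norm N x x0; rewrite lee_fin ler_norml => /andP[FqD _]; lra.
  under eq_integral do rewrite EFinD.
  rewrite integralD//; last first.
    exact: nu_w.
  rewrite nu_mu_w leeD2r//; exact: F_mu.
apply/integrableP; split.
  apply/measurable_EFinP; apply: (@measurable_funS _ _ _ _ setT) => //.
  by apply: measurable_funM => //; exact: measurable_funM.
apply: le_lt_trans Kfin.
rewrite (eq_integral (fun x => (q.[x] * w x * cosq (tau * x))%:E)); last first.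
  move=> x /set_mem/negE x0; rewrite gee0_abs// lee_fin !mulr_ge0 ?w_ge0//.
  by apply: le_trans ler01 (cosq_ge1 _); rewrite pmulr_rle0// ltW.
apply: (@integral_nd_limit_le _ _ _ _ _ F) => //.
- by move=> N; exact: measurable_funS (mF N).
- move=> x; rewrite /= in_itv/= => x0 M N MN; rewrite !FE ler_wpM2l ?mulr_ge0 ?w_ge0//.
  by apply: cosq_poly_nd => //; rewrite pmulr_rle0// ltW.
- move=> x _; under eq_fun do rewrite FE.
  by apply: cvgMr; exact: cosq_poly_cvg.
Qed.

(** Dominated convergence. The polynomial [p ^ 2 + 1] dominates [|p|] and is
    nonnegative everywhere, as [integrable_neg_part] requires. *)
Lemma multiplier_step (p : {poly R}) :
  nu.-integrable setT (fun x : R => (p.[x] * (w x * cosq (tau * x)))%:E) /\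
  (\int[nu]_x ((p * T N).[x] * w x)%:E @[N --> \oo] -->
   \int[nu]_x (p.[x] * (w x * cosq (tau * x)))%:E)%E.
Proof.
pose q : {poly R} := p ^+ 2 + 1.
have qE x : q.[x] = p.[x] ^+ 2 + 1 by rewrite hornerD horner_exp hornerC.
have q0 x : 0 <= q.[x] by rewrite qE addr_ge0// sqr_ge0.
have pq x : `|p.[x]| <= q.[x].
  rewrite qE -[p.[x] ^+ 2]real_normK ?num_real//.
  by have := sqr_ge0 (1 - `|p.[x]|); have := normr_ge0 (p.[x]); nra.
pose g (x : R) : R := `|p.[x]| * `|w x| * D x.
have g0 x : 0 <= g x by rewrite !mulr_ge0.
have mg : measurable_fun setT g.
  apply: measurable_funM => //; apply: measurable_funM; exact: measurableT_comp.
have gint : nu.-integrable setT (EFin \o g).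
  have ineg := integrable_neg_part q0.
  move/(integrable_mkcond _ mneg) : ineg => ineg.
  apply: le_integrable (integrableD measurableT (nu_cosq q) ineg) => //.
    exact/measurable_EFinP.
  move=> x _ /=; rewrite patchE; case: ifPn => [/set_mem/negE x0|/negP xneg].
    rewrite -EFinD/= lee_fin (ger0_norm (g0 x)).
    have -> : cosq (tau * x) = D x.
      by rewrite /D ltr0_norm ?opprK// pmulr_rlt0.
    apply: (@le_trans _ _ (q.[x] * w x * D x)).
      by rewrite /g (ger0_norm (w_ge0 x0)) ler_wpM2r// ler_wpM2r// w_ge0.
    rewrite [leRHS]ger0_norm; first by rewrite lerDr; exact: mulr_ge0 (q0 x) (D_ge0 x).
    by apply: addr_ge0; rewrite ?mulr_ge0 ?w_ge0//; exact: D_ge0.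
  have x0 : 0 <= x by rewrite leNgt; apply/negP => x0; apply: xneg; rewrite inE/= in_itv.
  rewrite adde0 lee_fin (ger0_norm (g0 x)) [leRHS]ger0_norm; last first.
    exact: mulr_ge0 (q0 x) (D_ge0 x).
  by rewrite /g ler_wpM2r// -[leRHS]mulr1 ler_pM// w_norm.
have [] := @dominated_convergence _ _ _ nu setT measurableT
  (fun N x => ((p * T N).[x] * w x)%:E)
  (fun x => (p.[x] * (w x * cosq (tau * x)))%:E) (EFin \o g).
- by move=> N; apply/measurable_EFinP; exact: measurable_funM.
- by apply/measurable_EFinP; apply: measurable_funM => //; exact: measurable_funM.
- apply: aeW => x _; apply: cvg_EFin; first exact: nearW.
  apply: (@cvg_trans _ (p.[x] * (w x * (cosq_poly N).[tau * x]) @[N --> \oo])).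
    apply: near_eq_cvg; near=> N => /=.
    by rewrite hornerM TE; ring.
  by apply: cvgMr; apply: cvgMr; exact: cosq_poly_cvg.
- by [].
- apply: aeW => x N _; rewrite /= lee_fin hornerM !normrM /g mulrAC.
  by rewrite ler_wpM2l// mulr_ge0.
by move=> *; split.
Unshelve. all: by end_near. Qed.

End multiplier_step.

(** * Polynomial approximation of a step *)

Lemma bernoulli_inequality (R : realFieldType) (d : R) n :
  -1 <= d -> 1 + n%:R * d <= (1 + d) ^+ n.
Proof.
move=> d1; elim: n => [|n IH]; first by rewrite mul0r addr0 expr0.
have d0 : 0 <= 1 + d by lra.
rewrite exprSr; apply: le_trans (ler_wpM2r d0 IH).
rewrite -natr1.
by have := mulr_ge0 (ler0n R n) (sqr_ge0 d); nra.
Qed.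

(** Take [s] with [q <= s ^ 2] and [s < 1]: then [n q ^ n <= (n s ^ n) s ^ n],
    and [n s ^ n] is bounded by the Bernoulli inequality. *)
Lemma cvg_natM_expr (R : realType) (q : R) : 0 <= q < 1 ->
  n%:R * q ^+ n @[n --> \oo] --> 0.
Proof.
move=> /andP[q0 q1].
pose s := (1 + q) / 2.
have s0 : 0 < s by rewrite /s; lra.
have s1 : s < 1 by rewrite /s; lra.
have qs : q <= s ^+ 2 by rewrite /s; have := sqr_ge0 (1 - q); nra.
pose d := s^-1 - 1.
have d0 : 0 < d by rewrite subr_gt0 invf_gt1.
have cvs : d^-1 * s ^+ n @[n --> \oo] --> 0.
  rewrite -[0](mulr0 d^-1); apply: cvgMr; apply: cvg_expr.
  by rewrite ger0_norm// ltW.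
apply: (squeeze_cvgr _ (cvg_cst 0) cvs).
near=> n; apply/andP; split; first by rewrite mulr_ge0// exprn_ge0.
apply: (@le_trans _ _ (n%:R * s ^+ n * s ^+ n)).
  rewrite -mulrA ler_wpM2l// -exprD addnn -mul2n exprM.
  by rewrite lerXn2r ?nnegrE// exprn_ge0// ltW.
rewrite ler_wpM2r ?exprn_ge0 ?(ltW s0)//.
have : 1 + n%:R * d <= s^-1 ^+ n.
  have -> : s^-1 = 1 + d by rewrite /d; ring.
  by apply: bernoulli_inequality; lra.
rewrite exprVn => H.
rewrite -[leRHS]mul1r ler_pdivlMr// mulrAC -ler_pdivlMr ?exprn_gt0// mul1r.
by apply: le_trans H; rewrite lerDr.
Unshelve. all: by end_near. Qed.

(** The exponent [n 2 ^ n] outgrows [2 ^ n] but is negligible against [u ^ - n]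
    for [u < 1 / 2], so that the limit is a step function that vanishes at the
    threshold too. *)
Lemma cvg_step_poly (R : realType) (u : R) : 0 <= u <= 1 ->
  (1 - u ^+ n) ^+ (n * 2 ^ n) @[n --> \oo] --> ((u < 2^-1)%R%:R : R).
Proof.
move=> /andP[u0 u1].
have un n : 0 <= u ^+ n <= 1 by rewrite exprn_ge0//= exprn_ile1.
have [uh|uh] := ltP u 2^-1.
  have cv : 1 - n%:R * (2 * u) ^+ n @[n --> \oo] --> (1 - 0 : R).
    by apply: cvgB; [exact: cvg_cst|apply: cvg_natM_expr; lra].
  rewrite subr0 in cv; apply: (squeeze_cvgr _ cv (cvg_cst _)).
  near=> n; have /andP[un0 un1] := un n; apply/andP; split.
    have := @bernoulli_inequality R (- u ^+ n) (n * 2 ^ n); rewrite lerN2.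
    move=> /(_ un1); apply: le_trans.
    by rewrite natrM natrX exprMn mulrN mulrA.
  by rewrite exprn_ile1 ?subr_ge0// lerBlDr lerDl.
apply: (squeeze_cvgr _ (cvg_cst 0) (@cvgn_expR R)).
near=> n; have /andP[un0 un1] := un n; apply/andP; split.
  by rewrite exprn_ge0// subr_ge0.
apply: (@le_trans _ _ (expR (- u ^+ n) ^+ (n * 2 ^ n))).
  by rewrite lerXn2r ?nnegrE ?subr_ge0 ?expR_ge0//; exact: expR_ge1Dx.
rewrite -expRM_natr ler_expR natrM natrX mulNr lerN2 mulrCA ler_peMr//.
rewrite -exprMn exprn_ege1//; lra.
Unshelve. all: by end_near. Qed.

Lemma cosq_lt (R : realType) (y z : R) : 0 < y <= 1 -> 0 <= z <= 1 ->
  (cosq y < cosq z) = (z < y).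
Proof.
move=> /andP[y0 y1] /andP[z0 z1]; rewrite /cosq (ltW y0) z0.
have sq (t : R) : 0 <= t -> t <= 1 -> Num.sqrt t \in `[0, pi].
  move=> t0 t1; rewrite in_itv/= sqrtr_ge0/=.
  apply: (@le_trans _ _ 1); first by rewrite -sqrtr1 ler_wsqrtr.
  by apply: le_trans (pi_ge2 R); rewrite ler1n.
by rewrite ltr_cos ?sq ?(ltW y0)// ltr_sqrt.
Qed.

(** * Determinacy under factorial growth *)

Section determinacy.
Context {R : realType} (mu Q : probability R R) (C B : R).
Hypotheses (C0 : 0 <= C) (B1 : 1 <= B).
Hypothesis mu_int : forall k, mu.-integrable setT (fun x : R => (x ^+ k)%:E).
Hypothesis Q_int : forall k, Q.-integrable setT (fun x : R => (x ^+ k)%:E).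
Hypothesis Q_mu : forall k, (\int[Q]_x (x ^+ k)%:E = \int[mu]_x (x ^+ k)%:E)%E.
Hypothesis mu_growth : forall k,
  (\int[mu]_x (x ^+ k)%:E <= (C * B ^+ k * (2 * k)`!%:R)%:E)%E.
Hypothesis mu_neg : mu `]-oo, 0%R[%classic = 0%E.

Let neg : set R := `]-oo, 0%R[%classic.

Let mneg : measurable neg. Proof. exact: measurable_itv. Qed.

(** The bounds on the two half-lines are what [multiplier_step] needs to pass
    from [w] to [w * cosq (tau * _)], which inherits them. *)
Definition moment_multiplier (w : R -> R) : Prop :=
  [/\ measurable_fun setT w, forall x, 0 <= x -> `|w x| <= 1,
      forall x, x < 0 -> 0 <= w x &
      forall p : {poly R},
      [/\ mu.-integrable setT (fun x : R => (p.[x] * w x)%:E),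
          Q.-integrable setT (fun x : R => (p.[x] * w x)%:E) &
          (\int[Q]_x (p.[x] * w x)%:E = \int[mu]_x (p.[x] * w x)%:E)%E]].

Lemma moment_multiplier1 : moment_multiplier (fun=> 1).
Proof.
split=> [|x _|x _|p]; [exact: measurable_cst|by rewrite normr1|exact: ler01|].
have pE : (fun x : R => (p.[x] * 1)%:E) =
    (fun x : R => \sum_(i <- iota 0 (size p)) (p`_i)%:E * (x ^+ i)%:E)%E.
  apply/funext => x; rewrite mulr1 horner_coef.
  by rewrite -(big_mkord xpredT (fun i => p`_i * x ^+ i)) /index_iota subn0 sumEFin.
have intQ i : Q.-integrable setT (fun x : R => (p`_i)%:E * (x ^+ i)%:E)%E.
  exact: integrableZl.
have intmu i : mu.-integrable setT (fun x : R => (p`_i)%:E * (x ^+ i)%:E)%E.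
  exact: integrableZl.
rewrite pE; split; [exact: integrable_sum|exact: integrable_sum|].
rewrite !integral_sum//; apply: eq_bigr => i _.
by rewrite !integralZl// Q_mu.
Qed.

Lemma moment_multiplier_step (tau : R) (w : R -> R) : 0 < tau -> 8 * tau * B <= 1 ->
  moment_multiplier w -> moment_multiplier (fun x => w x * cosq (tau * x)).
Proof.
move=> tau0 tauB [mw w_norm w_ge0 ew].
have mu_cosq p := integrable_poly_cosq C0 B1 mu_int mu_growth p tau0 tauB.
have Q_growth k : (\int[Q]_x (x ^+ k)%:E <= (C * B ^+ k * (2 * k)`!%:R)%:E)%E.
  by rewrite Q_mu.
have Q_cosq p := integrable_poly_cosq C0 B1 Q_int Q_growth p tau0 tauB.
have mu_w p : mu.-integrable setT (fun x : R => (p.[x] * w x)%:E) by have [] := ew p.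
have Q_w p : Q.-integrable setT (fun x : R => (p.[x] * w x)%:E) by have [] := ew p.
have QE p : (\int[Q]_x (p.[x] * w x)%:E = \int[mu]_x (p.[x] * w x)%:E)%E.
  by have [] := ew p.
split.
- apply: measurable_funM => //.
  apply: (@measurableT_comp _ _ _ _ _ _ cosq); first exact: measurable_cosq.
  exact: measurable_funM.
- move=> x x0; rewrite normrM -[leRHS]mulr1 ler_pM// ?w_norm// cosq_norm_le1//.
  by rewrite mulr_ge0// ltW.
- move=> x x0; rewrite mulr_ge0 ?w_ge0//; apply: le_trans ler01 (cosq_ge1 _).
  by rewrite pmulr_rle0// ltW.
move=> p.
have [imu cmu] := multiplier_step mw w_norm w_ge0 tau0 mu_neg mu_cosq mu_cosq
  mu_w mu_w (fun=> erefl) p.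
have [iQ cQ] := multiplier_step mw w_norm w_ge0 tau0 mu_neg mu_cosq Q_cosq
  mu_w Q_w QE p.
split=> //; move: cQ; under eq_fun do rewrite QE.
move=> cQ; exact: (cvg_unique _ cQ cmu).
Qed.

(** The scale up to which [integrable_poly_cosq] applies. *)
Let tau0 : R := (8 * B)^-1.

Let tau0_gt0 : 0 < tau0.
Proof. by rewrite invr_gt0 mulr_gt0// (lt_le_trans ltr01). Qed.

Lemma moment_multiplier_cosqX (tau : R) n : 0 < tau <= tau0 ->
  moment_multiplier (fun x => cosq (tau * x) ^+ n).
Proof.
move=> /andP[tau_gt0 tau_le].
have B0 : 0 < B by exact: lt_le_trans B1.
have tauB : 8 * tau * B <= 1.
  by rewrite mulrAC mulrC -ler_pdivlMr ?mulr_gt0// div1r.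
elim: n => [|n IH].
  by under eq_fun do rewrite expr0; exact: moment_multiplier1.
by under eq_fun do rewrite exprSr; exact: moment_multiplier_step.
Qed.

Let B0 : 0 < B. Proof. exact: lt_le_trans B1. Qed.

(** The [mu]-integrals of [cosq (tau0 x) ^ n] are at most 1, whereas on the
    left the function is at least [1 + n tau0 |x| / 2]. So the [Q]-integral of
    [|x|] over the left half-line is [O(1 / n)] for every [n]. *)
Lemma competitor_neg_eq0 : Q neg = 0%E.
Proof.
have tau_ok : 0 < tau0 <= tau0 by rewrite tau0_gt0 lexx.
pose a : R := tau0 / 2.
have a0 : 0 < a by rewrite divr_gt0.
have mabs : measurable_fun setT (fun x : R => a * `|x|).
  by apply: measurable_funM => //; exact: measurableT_comp.
have prob1 (nu : probability R R) : nu [set: R] = 1%E by exact: probability_setT.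
pose I := (\int[Q]_(x in neg) (a * `|x|)%:E)%E.
have I0 : (0 <= I)%E.
  by apply: integral_ge0 => x _; rewrite lee_fin mulr_ge0// ltW.
have key n : (n%:R%:E * I <= 2%:E)%E.
  have [mw w_norm w_ge0 /(_ 1)[imu iQ QE]] := moment_multiplier_cosqX n tau_ok.
  set w := (fun x : R => cosq (tau0 * x) ^+ n) in mw w_norm w_ge0 imu iQ QE.
  have wE : (fun x : R => (1.[x] * w x)%:E) = (fun x : R => (w x)%:E).
    by apply/funext => x; rewrite hornerC mul1r.
  rewrite wE in imu; rewrite wE in iQ; rewrite wE in QE.
  rewrite -ge0_integralZl_EFin//; last 2 first.
    by move=> x _; rewrite lee_fin mulr_ge0// ltW.
    by apply/measurable_EFinP; exact: measurable_funS mabs.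
  have one_int (nu : probability R R) : nu.-integrable setT (fun=> 1%:E : \bar R).
    exact: (finite_measure_integrable_cst nu 1 measurableT).
  (* Adding 1 makes the integrand nonnegative on the right as well. *)
  apply: (@le_trans _ _ (\int[Q]_x (w x + 1)%:E)%E).
    rewrite [leLHS]integral_mkcond; apply: ge0_le_integral => //.
    - move=> x _; rewrite patchE; case: ifPn => // _.
      by rewrite -EFinM lee_fin !mulr_ge0// ltW.
    - apply/(measurable_restrictT _ mneg); apply/measurable_EFinP.
      by apply: measurable_funM => //; exact: measurable_funS mabs.
    - by apply/measurable_EFinP; exact: measurable_funD.
    - move=> x _; rewrite patchE; case: ifPn => [/set_mem|/negP xneg].
        rewrite /neg/= in_itv/= => x0; rewrite -EFinM lee_fin.
        have tx0 : tau0 * x <= 0 by rewrite pmulr_rle0// ltW.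
        have ax : 1 + a * `|x| <= cosq (tau0 * x).
          apply: le_trans (cosq_ge1D tx0); rewrite ltr0_norm// /a.
          by rewrite le_eqVlt; apply/orP; left; apply/eqP; ring.
        have : (1 + a * `|x|) ^+ n <= w x.
          rewrite /w lerXn2r// nnegrE ?(le_trans ler01 (cosq_ge1 _))//.
          by rewrite addr_ge0// mulr_ge0// ltW.
        have ax0 : 0 <= a * `|x| by rewrite mulr_ge0// ltW.
        have : -1 <= a * `|x| by lra.
        move=> /(bernoulli_inequality n); lra.
      have x0 : 0 <= x.
        rewrite leNgt; apply/negP => x0; apply: xneg; apply: mem_set.
        by rewrite /neg/= in_itv.
      by have := w_norm x x0; rewrite lee_fin ler_norml /w => /andP[h _]; lra.
  have intD (nu : probability R R) : nu.-integrable setT (fun x : R => (w x)%:E) ->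
      (\int[nu]_x (w x + 1)%:E = \int[nu]_x (w x)%:E + \int[nu]_x 1)%E.
    by move=> iw; rewrite -(integralD measurableT iw (one_int nu)).
  have intD1 : mu.-integrable setT (fun x : R => (w x + 1)%:E).
    by have := integrableD measurableT imu (one_int mu).
  have -> : (\int[Q]_x (w x + 1)%:E = \int[mu]_x (w x + 1)%:E)%E.
    rewrite (intD Q iQ) (intD mu imu) QE; congr (_ + _)%E.
    rewrite !integral_cst//; congr (_ * _)%E.
    exact: etrans (prob1 Q) (esym (prob1 mu)).
  rewrite (_ : 2%:E = \int[mu]_x (cst 2%:E) x)%E; last first.
    by rewrite integral_cst// -[LHS]mule1; congr (_ * _)%E; exact: esym (prob1 mu).
  rewrite (negligible_integral mneg measurableT _ mu_neg); last exact: intD1.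
  rewrite [leRHS](negligible_integral mneg measurableT _ mu_neg); last first.
    exact: (finite_measure_integrable_cst mu 2 measurableT).
  apply: le_integral.
  - exact: measurableD.
  - by apply: (@integrableS _ _ _ _ setT); [|exact: measurableD|by []|exact: intD1].
  - apply: (@integrableS _ _ _ _ setT); [|exact: measurableD|by []|] => //.
    exact: (finite_measure_integrable_cst mu 2 measurableT).
  move=> x /set_mem[_ /negP]; rewrite /= in_itv/= -leNgt => x0.
  by rewrite lee_fin; have := w_norm x x0; rewrite ler_norml /w => /andP[_ h]; lra.
have I_eq0 : I = 0%E.
  have Ifin : I \is a fin_num.
    by rewrite ge0_fin_numE//; have := key 1%N; rewrite mul1e => /le_lt_trans; apply; exact: ltry.
  apply/eqP; rewrite eq_le I0 andbT -(fineK Ifin) lee_fin leNgt; apply/negP => I_gt0.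
  pose n := Num.bound (2 / fine I).
  have : 2 / fine I < n%:R by apply: archi_boundP; rewrite divr_ge0// ltW.
  rewrite ltr_pdivrMr//; apply/negP; rewrite -leNgt.
  by have := key n; rewrite -(fineK Ifin) -EFinM lee_fin.
have : (\int[Q]_(x in neg) `|(a * `|x|)%:E| = 0)%E.
  rewrite -I_eq0; apply: eq_integral => x _.
  by rewrite gee0_abs// lee_fin mulr_ge0// ltW.
have maE : measurable_fun neg (fun x : R => (a * `|x|)%:E).
  by apply/measurable_EFinP; exact: measurable_funS mabs.
move=> /(ae_eq_integral_abs Q mneg maE) ae0.
apply: measure_negligible => //; apply: negligibleS ae0 => x /= xneg /(_ xneg) [].
move/eqP; rewrite mulf_eq0 (gt_eqF a0)/= normr_eq0 => /eqP x_eq0.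
by move: xneg; rewrite /neg/= x_eq0 in_itv/= ltxx.
Qed.

Let pos : set R := ~` neg.

Let mpos : measurable pos. Proof. exact: measurableC. Qed.

Let posP (x : R) : pos x -> 0 <= x.
Proof. by rewrite /pos /neg/= in_itv/= leNgt => /negP. Qed.

(** Both measures live on [pos], where the test functions below are bounded. *)
Let agree (f : R -> R) : Prop :=
  (\int[Q]_(x in pos) (f x)%:E = \int[mu]_(x in pos) (f x)%:E)%E.

Lemma agree_bounded_limit (f_ : nat -> R -> R) (f : R -> R) (M : R) :
  (forall n, measurable_fun setT (f_ n)) ->
  (forall n x, 0 <= x -> `|f_ n x| <= M) ->
  (forall x, 0 <= x -> f_ n x @[n --> \oo] --> f x) ->
  (forall n, agree (f_ n)) -> agree f.
Proof.
move=> mf fM cf af.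
have mf' n : measurable_fun pos (f_ n) by exact: measurable_funS (mf n).
have mfl : measurable_fun pos f.
  by apply: (measurable_fun_cvg mf') => x /posP; exact: cf.
have cv (nu : probability R R) : (\int[nu]_(x in pos) (f_ n x)%:E @[n --> \oo] -->
    \int[nu]_(x in pos) (f x)%:E)%E.
  have [] // := @dominated_convergence _ _ _ nu pos mpos (fun n x => (f_ n x)%:E)
    (fun x => (f x)%:E) (cst M%:E).
  - by move=> n; exact/measurable_EFinP.
  - exact/measurable_EFinP.
  - apply: aeW => x /posP x0; apply: cvg_EFin; first exact: nearW.
    exact: cf.
  - exact: (finite_measure_integrable_cst nu M mpos).
  - by apply: aeW => x n /posP x0; rewrite /= lee_fin fM.
have := cv Q; under eq_fun do rewrite af.
by move=> cvQ; exact: (cvg_unique _ cvQ (cv mu)).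
Qed.

Lemma agree_poly_cosq (tau : R) (r : {poly R}) : 0 < tau <= tau0 ->
  agree (fun x => r.[cosq (tau * x)]).
Proof.
move=> tau_ok; rewrite /agree.
have pE : (fun x : R => (r.[cosq (tau * x)])%:E) =
    (fun x : R => \sum_(i <- iota 0 (size r))
      ((r`_i)%:P.[x] * cosq (tau * x) ^+ i)%:E)%E.
  apply/funext => x; rewrite horner_coef sumEFin.
  rewrite -(big_mkord xpredT (fun i => r`_i * cosq (tau * x) ^+ i)) /index_iota subn0.
  by under [in RHS]eq_bigr do rewrite hornerC.
have ex i : [/\ mu.-integrable setT (fun x : R => ((r`_i)%:P.[x] * cosq (tau * x) ^+ i)%:E),
  Q.-integrable setT (fun x : R => ((r`_i)%:P.[x] * cosq (tau * x) ^+ i)%:E) &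
  (\int[Q]_x ((r`_i)%:P.[x] * cosq (tau * x) ^+ i)%:E =
   \int[mu]_x ((r`_i)%:P.[x] * cosq (tau * x) ^+ i)%:E)%E].
  by have [_ _ _] := moment_multiplier_cosqX i tau_ok; exact.
have imu : mu.-integrable setT (fun x : R => (r.[cosq (tau * x)])%:E).
  by rewrite pE; apply: integrable_sum => // i _; have [] := ex i.
have iQ : Q.-integrable setT (fun x : R => (r.[cosq (tau * x)])%:E).
  by rewrite pE; apply: integrable_sum => // i _; have [] := ex i.
have := negligible_integral mneg measurableT imu mu_neg.
have := negligible_integral mneg measurableT iQ competitor_neg_eq0.
rewrite setTD -/pos => <- <-; rewrite pE !integral_sum//.
- by apply: eq_bigr => i _; have [] := ex i.
- by move=> i; have [] := ex i.
- by move=> i; have [] := ex i.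
Qed.

Let mcosq_tau (tau : R) : measurable_fun setT (fun x : R => cosq (tau * x)).
Proof.
apply: (@measurableT_comp _ _ _ _ _ _ cosq); first exact: measurable_cosq.
exact: measurable_funM.
Qed.

(** The affine map [u] sends [[-1, 1]] into [[0, 1]] and [c] to [1 / 2]; compose
    it with the polynomials of [cvg_step_poly]. *)
Lemma agree_cosq_gt (tau c : R) : 0 < tau <= tau0 -> `|c| <= 1 ->
  agree (fun x => (c < cosq (tau * x))%R%:R).
Proof.
move=> tau_ok; rewrite ler_norml => /andP[cge cle].
have tau_gt0 : 0 < tau by have /andP[] := tau_ok.
pose u : {poly R} := (2^-1 + c / 4)%:P - 4^-1 *: 'X.
have uE v : u.[v] = 2^-1 + c / 4 - v / 4.
  by rewrite /u hornerD hornerN hornerZ hornerX hornerC [4^-1 * v]mulrC.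
pose r n : {poly R} := (1 - u ^+ n) ^+ (n * 2 ^ n).
have rE n v : (r n).[v] = (1 - u.[v] ^+ n) ^+ (n * 2 ^ n).
  by rewrite /r horner_exp hornerD hornerN hornerC horner_exp.
have u01 x : 0 <= x -> 0 <= u.[cosq (tau * x)] <= 1.
  move=> x0; have : `|cosq (tau * x)| <= 1.
    by rewrite cosq_norm_le1// mulr_ge0// ltW.
  by rewrite ler_norml uE => /andP[? ?]; lra.
apply: (@agree_bounded_limit (fun n x => (r n).[cosq (tau * x)]) _ 1).
- move=> n; apply: (@measurableT_comp _ _ _ _ _ _ (horner (r n))) => //.
  exact: measurable_poly.
- move=> n x /u01/andP[u0 u1]; rewrite rE normrX exprn_ile1//.
  have : 0 <= u.[cosq (tau * x)] ^+ n <= 1 by rewrite exprn_ge0//= exprn_ile1.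
  by move=> /andP[? ?]; rewrite ger0_norm; lra.
- move=> x /u01/cvg_step_poly.
  have -> : (u.[cosq (tau * x)] < 2^-1) = (c < cosq (tau * x)).
    by rewrite uE; apply/idP/idP => ?; lra.
  by under [in X in _ -> X]eq_fun do rewrite rE.
- by move=> n; exact: agree_poly_cosq.
Qed.

(** For [tau] small enough, depending on [x], the arguments [tau x] and [tau b]
    both lie in the interval [[0, 1]], on which [cosq] is decreasing. *)
Lemma agree_lt (b : R) : 0 < b -> agree (fun x => (x < b)%R%:R).
Proof.
move=> b0.
pose tau (m : nat) : R := tau0 / m.+1%:R.
have tau_gt0 m : 0 < tau m by rewrite divr_gt0.
have tau_le m : tau m <= tau0 by rewrite ler_pdivrMr// ler_peMr ?ler1n// ltW.
have tau_small y : 0 <= y -> \forall m \near \oo, tau m * y <= 1.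
  move=> y0; near=> m; rewrite mulrAC ler_pdivrMr// mul1r.
  apply: le_trans (_ : m%:R <= _); last by rewrite ler_nat.
  by near: m; exact: nbhs_infty_ger.
apply: (@agree_bounded_limit (fun m x => (cosq (tau m * b) < cosq (tau m * x))%R%:R) _ 1).
- move=> m; rewrite (_ : (fun x => _) = fun x =>
      if cosq (tau m * b) < cosq (tau m * x) then 1 else 0); last first.
    by apply/funext => x; case: ifP.
  apply: measurable_fun_ifT => //.
  apply: measurable_fun_ltr; first exact: measurable_cst.
  exact: mcosq_tau.
- by move=> m x _; case: (_ < _); rewrite ?normr1 ?normr0.
- move=> x x0; apply: cvg_near_cst; near=> m.
  have tb : 0 < tau m * b <= 1.
    apply/andP; split; first exact: mulr_gt0 (tau_gt0 m) b0.
    by near: m; apply: tau_small; exact: ltW.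
  have tx : 0 <= tau m * x <= 1.
    apply/andP; split; first exact: mulr_ge0 (ltW (tau_gt0 m)) x0.
    by near: m; exact: tau_small.
  by rewrite (cosq_lt tb tx) (ltr_pM2l (tau_gt0 m)).
- move=> m; apply: agree_cosq_gt; rewrite ?tau_gt0 ?tau_le//.
  apply: cosq_norm_le1; exact: mulr_ge0 (ltW (tau_gt0 m)) (ltW b0).
Unshelve. all: by end_near. Qed.

(** A determinacy criterion on the whole line: [mu] is supported by the
    half-line, but no such assumption is made on [Q]. *)
Theorem determinate_of_growth (A : set R) : measurable A -> Q A = mu A.
Proof.
apply: (@measure_unique _ R R (@RGenInftyO.G R)
  (fun n : nat => (`]-oo, n%:R%R[%classic : set R)) _ _ _ _ Q mu).
- exact: RGenInftyO.measurableE.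
- move=> _ _ [x ->] [y ->]; exists (Num.min x y).
  by apply/seteqP; split => z; rewrite /= !in_itv/= lt_min; [move=> [-> ->]|move=> /andP].
- by move=> i; exists i%:R.
- apply/seteqP; split => // x _; exists (Num.bound `|x|) => //=.
  rewrite in_itv/=; apply: le_lt_trans (ler_norm x) _.
  exact: archi_boundP.
- move=> _ [b ->]; have [b0|b0] := leP b 0.
    have sub : `]-oo, b[%classic `<=` neg.
      by move=> z; rewrite /neg/= !in_itv/= => /lt_le_trans; apply.
    have null (nu : probability R R) : nu neg = 0%E -> nu `]-oo, b[%classic = 0%E.
      by move=> nu0; apply: subset_measure0 nu0 => //; exact: measurable_itv.
    exact: etrans (null Q competitor_neg_eq0) (esym (null mu mu_neg)).
  have H (nu : probability R R) : nu neg = 0%E ->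
      (\int[nu]_(x in pos) ((x < b)%R%:R)%:E = nu `]-oo, b[%classic)%E.
    move=> nu0.
    have mb : measurable (`]-oo, b[%classic : set R) by exact: measurable_itv.
    have nuI0 : nu (`]-oo, b[%classic `&` neg) = 0%E.
      by apply: subset_measure0 nu0; [exact: measurableI|by []|exact: subIsetr].
    have nuD : (nu `]-oo, b[%classic = nu (`]-oo, b[%classic `\` neg) +
        nu (`]-oo, b[%classic `&` neg))%E by exact: measureDI.
    rewrite nuD nuI0 adde0 setDE -/pos -integral_indic//.
    apply: eq_integral => x _; rewrite indicE; congr (_%:R)%:E.
    by rewrite mem_setE in_itv.
  have := agree_lt b0; rewrite /agree => agree_b.
  exact: etrans (esym (H Q competitor_neg_eq0)) (etrans agree_b (H mu mu_neg)).
- by move=> n; rewrite (le_lt_trans (probability_le1 _ _))// ltry.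
Qed.

End determinacy.

(** * Moments of the product *)

Lemma momentE (R : realType) (d : measure_display) (T : measurableType d)
    (P : probability T R) (X : T -> R) k :
  moment P X k = (\int[P]_t (X t ^+ k)%:E)%E.
Proof. by rewrite /moment unlock. Qed.

Lemma integrable_expr (R : realType) (d : measure_display) (T : measurableType d)
    (P : probability T R) (X : T -> R) k :
  finite_moments P X -> P.-integrable setT (fun t => (X t ^+ k)%:E).
Proof.
move=> fX; case: k => [|k]; last exact: fX.
exact: (finite_measure_integrable_cst P 1 measurableT).
Qed.

Section product_of_independent.
Context {R : realType} {d : measure_display} {T : measurableType d}.
Context {P : probability T R} {n : nat} (xi : 'I_n -> {RV P >-> R}).
Hypothesis xi_indep : independent_RVs xi.
Hypothesis xi_ge0 : forall i, {ae P, forall t, 0 <= xi i t}.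
Hypothesis xi_mom : forall i, finite_moments P (xi i).

Lemma rv_prod_ge0 : {ae P, forall t, 0 <= rv_prod xi t}.
Proof.
have : {ae P, forall t, forall i, 0 <= xi i t} by apply: filter_forall.
by apply: filterS => t xit; apply: prodr_ge0 => i _.
Qed.

(** Absolute values make the factors nonnegative everywhere, and almost surely
    do not change them. *)
Lemma abs_moment_rv_prod k : (\int[P]_t (`|rv_prod xi t| ^+ k)%:E =
  (\prod_i fine (moment P (xi i) k))%:E)%E.
Proof.
have int_abs i : P.-integrable setT (fun t => (`|xi i t| ^+ k)%:E).
  have := integrable_expr k (xi_mom i) => /integrable_norm.
  by apply: eq_integrable => // t _; rewrite /= normrX.
have absE i : (\int[P]_t (`|xi i t| ^+ k)%:E = (fine (moment P (xi i) k))%:E)%E.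
  rewrite fineK momentE; last exact: integrable_fin_num (integrable_expr k (xi_mom i)).
  apply: ae_eq_integral => //.
  - exact: measurable_int (int_abs i).
  - exact: measurable_int (integrable_expr k (xi_mom i)).
  - by apply: filterS (xi_ge0 i) => t xit _; rewrite ger0_norm.
rewrite -prodEFin -(eq_bigr _ (fun i _ => absE i)).
rewrite -(@integral_prod_independent _ _ _ _ _ xi (fun _ x => `|x| ^+ k))//.
- apply: eq_integral => t _; congr EFin.
  by rewrite /= /rv_prod_fun normr_prod prodrXl.
- by move=> i; apply: measurable_funX; exact: normr_measurable.
Qed.

Lemma integrable_rv_prod k : P.-integrable setT (fun t => (rv_prod xi t ^+ k)%:E).
Proof.
apply/integrableP; split.
  by apply/measurable_EFinP; apply: measurable_funX; exact: measurable_funP.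
under eq_integral do rewrite abse_EFin normrX.
by rewrite abs_moment_rv_prod ltry.
Qed.

End product_of_independent.

Theorem theorem5 (R : realType) (d : measure_display) (T : measurableType d)
    (P : probability T R) (n : nat) (hn : (0 < n)%N)
    (xi : 'I_n -> {RV P >-> R}) (a : 'I_n -> R)
    (xi_indep : independent_RVs xi)
    (xi_ge0 : forall i, {ae P, forall t, 0 <= xi i t})
    (xi_mom : forall i, finite_moments P (xi i))
    (a_gt0 : forall i, 0 < a i)
    (xi_growth : forall i,
      (fun k : nat => fine (moment P (xi i) k)) =O_\oo
      (fun k : nat => k%:R `^ (a i * k%:R)))
    (a_sum : \sum_(i < n) a i <= 2) :
  moment_determinate (rv_prod xi).
Proof.
have Zint k := integrable_rv_prod xi_indep xi_ge0 xi_mom k.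
split=> [k _|Q Qmom QE A mA]; first exact: Zint.
have [C [B [C0 B1 growth]]] := prod_growth_factorial xi_growth a_sum.
pose mu := distribution P (rv_prod xi).
have mX k : measurable_fun setT (fun x : R => (x ^+ k)%:E).
  by apply/measurable_EFinP; exact: exprn_measurable.
have muE k : (\int[mu]_x (x ^+ k)%:E = \int[P]_t (rv_prod xi t ^+ k)%:E)%E.
  exact: (integral_distribution (mX k) (Zint k)).
have mu_int k : mu.-integrable setT (fun x : R => (x ^+ k)%:E).
  exact: (integrable_pushforward _ (mX k) (Zint k) measurableT).
have Zabs_int k : P.-integrable setT (fun t => (`|rv_prod xi t| ^+ k)%:E).
  by under eq_fun do rewrite -normrX; exact: integrable_norm (Zint k).
(* The hypothesis on Q starts at k = 1; for k = 0 both integrals are the total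
   mass. *)
have mass1 d' (T' : measurableType d') (nu : probability T' R) :
    (\int[nu]_x cst 1%:E x = 1)%E.
  by rewrite integral_cst// mul1e; exact: probability_setT.
apply: (@determinate_of_growth R mu Q C B) => //.
- by move=> k; exact: integrable_expr Qmom.
- move=> k; rewrite muE; case: k => [|k].
    exact: etrans (mass1 _ _ Q) (esym (mass1 _ _ P)).
  exact: etrans (esym (momentE Q idfun k.+1)) (etrans (QE k.+1 isT) (momentE P (rv_prod xi) k.+1)).
- move=> k; rewrite muE; apply: (@le_trans _ _ (\int[P]_t (`|rv_prod xi t| ^+ k)%:E)%E).
    apply: le_integral => //.
    by move=> t _; rewrite lee_fin -normrX ler_norm.
  rewrite abs_moment_rv_prod// lee_fin; exact: le_trans (ler_norm _) (growth k).
have mneg : measurable ((rv_prod xi : T -> R) @^-1` `]-oo, 0[%classic).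
  have mI : measurable (`]-oo, 0[%classic : set R) by exact: measurable_itv.
  by rewrite -[X in measurable X]setTI; exact: measurable_funP.
suff : P ((rv_prod xi : T -> R) @^-1` `]-oo, 0[%classic) = 0%E by [].
apply: measure_negligible => //.
apply: negligibleS (rv_prod_ge0 xi_ge0) => t /=; rewrite in_itv/= => Zt_lt0.
by move=> Zt_ge0; move: Zt_lt0; rewrite ltNge Zt_ge0.
Qed.
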